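(* Let $f$ be a $5$-nomial in three variables such that $\dim\mathrm{Newt}(f)=3$, and let $Z:=f^{-1}(0)\subset\mathbb{R}_+^3$. Then $\mathrm{Non}(Z)\le 12$, i.e. $Z$ has at most $12$ non-compact connected components.
   Context: $\mathbb{R}_+^n = \{(x_1,\dots,x_n)\in\mathbb{R}^n : x_k>0 \text{ for } 1\le k\le n\}$. For $x\in\mathbb{R}_+^n$ and $a=(a_1,\dots,a_n)\in\mathbb{R}^n$, $x^a := x_1^{a_1}\cdots x_n^{a_n}$. An $m$-nomial in $n$ variables is a function $f:\mathbb{R}_+^n\to\mathbb{R}$ of the form $f(x)=\sum_{i=1}^m c_i x^{a_i}$ with $c_i\in\mathbb{R}$, $c_i\neq 0$, and pairwise distinct exponent vectors $a_i\in\mathbb{R}^n$. The Newton polytope $\mathrm{Newt}(f)$ is the convex hull of $\{a_1,\dots,a_m\}$, and $\dim\mathrm{Newt}(f)$ is the dimension of its affine span. $\mathrm{Non}(X)$ is the number of non-compact connected components of $X\subset\mathbb{R}_+^n$ (a bounded component may be non-compact, since $\mathbb{R}_+^n$ is not closed). *)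

(* Defs.v *)
From mathcomp Require Import all_boot all_order all_algebra.
From mathcomp Require Import all_classical all_reals all_analysis.

Set Implicit Arguments.
Unset Strict Implicit.
Unset Printing Implicit Defensive.

Import Order.TTheory GRing.Theory Num.Theory.
Import numFieldNormedType.Exports.

Local Open Scope classical_set_scope.
Local Open Scope ring_scope.

Definition pos_orthant (R : realType) (n : nat) : set 'rV[R]_n :=
  [set x | forall k : 'I_n, 0 < x 0 k].

Definition monomial (R : realType) (n : nat) (x a : 'rV[R]_n) : R :=
  \prod_(k < n) x 0 k `^ a 0 k.

(* A function on the open positive orthant is represented by a total function,
   constrained and used only on [pos_orthant]. *)
Definition is_nomial (R : realType) (m n : nat) (c : 'I_m -> R)
    (a : 'I_m -> 'rV[R]_n) (f : 'rV[R]_n -> R) : Prop :=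
  [/\ forall i, c i != 0,
      injective a &
      forall x, pos_orthant x -> f x = \sum_(i < m) c i * monomial x (a i)].

Definition convex_hull (R : realType) (n : nat) (A : set 'rV[R]_n) :
  set 'rV[R]_n := smallest (@convex_set R 'rV[R]_n) A.

Definition newton_polytope (R : realType) (m n : nat) (a : 'I_m -> 'rV[R]_n) :
  set 'rV[R]_n := convex_hull (range a).

Definition affine_subspace (R : realType) (n d : nat) (A : set 'rV[R]_n) :
    Prop :=
  exists (p : 'rV[R]_n) (V : {vspace 'rV[R]_n}),
    \dim V = d /\ A = [set p + v | v in [set` V]].

Definition affine_span (R : realType) (n : nat) (A : set 'rV[R]_n) :
  set 'rV[R]_n := smallest [set B | exists d, affine_subspace d B] A.

Definition has_affine_dim (R : realType) (n : nat) (A : set 'rV[R]_n)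
  (d : nat) : Prop := affine_subspace d (affine_span A).

Definition zero_set (R : realType) (n : nat) (f : 'rV[R]_n -> R) :
  set 'rV[R]_n := @pos_orthant R n `&` f @^-1` [set 0].

Definition noncompact_components (T : topologicalType) (X : set T) :
    set (set T) :=
  [set C | (exists2 x, X x & C = connected_component X x) /\ ~ compact C].

(* Main.v *)
(* Put u_i = |c_i| x^(a_i). Since the Newton polytope is full-dimensional, the
   exponents satisfy exactly one affine dependency l, and x |-> (u_i) identifies
   Z with the set of positive u, modulo scaling, such that
   sum_i sgn(c_i) u_i = 0 and sum_i l_i ln u_i is a given constant t.
   Repeatedly splitting the sums of the terms of equal sign parametrises the
   solutions of the first equation by (x, y, z) in (0,1)^3, each u_i being a
   product of factors among x, 1-x, y, 1-y, z, 1-z. The second equation then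
   separates as g1(x) + g2(y) + g3(z) = t with g(s) = A ln s + B ln(1-s). Each
   such g is monotone on two subintervals, which cuts the cube into 8 boxes, and
   the part of the level set inside a box is connected. So Z has at most 8
   connected components, compact or not. *)

Require Import Defs.
From mathcomp Require Import all_boot all_order all_algebra.
From mathcomp Require Import all_classical all_reals all_analysis.
From mathcomp Require Import all_fingroup zify ring lra.
Import Order.TTheory GRing.Theory Num.Theory.
Import numFieldNormedType.Exports.
Local Open Scope classical_set_scope.
Local Open Scope ring_scope.
Local Open Scope card_scope.

Set Implicit Arguments.
Unset Strict Implicit.
Unset Printing Implicit Defensive.

(** * The one-variable function A ln s + B ln(1-s) on (0,1) and its monotone branches *)

Section LogMix.
Context {R : realType}.
Implicit Types (A B s r x y z v : R).

Definition logmix A B s : R := A * ln s + B * ln (1 - s).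

(** The derivative A/s - B/(1-s) is nonnegative, with denominators cleared. The condition is affine
    in s, so each truth value is taken on an interval. *)
Definition rising A B s : bool := B * s <= A * (1 - s).

Lemma logmixC A B s : logmix A B s = logmix B A (1 - s).
Proof. by rewrite /logmix addrC; congr (_ + _ * ln _); ring. Qed.

Lemma logmixN A B s : logmix (- A) (- B) s = - logmix A B s.
Proof. by rewrite /logmix; ring. Qed.

(** Strict concavity of ln: apply exp(d) > 1 + d to d = ln x - ln y and multiply by y. These tangent
    bounds replace differentiation in the monotonicity proofs below. *)
Lemma ln_chord_lt x y : 0 < x -> 0 < y -> x != y -> y * (ln x - ln y) < x - y.
Proof.
move=> x0 y0 xy.
have l0 : ln x - ln y != 0.
  by rewrite subr_eq0; apply: contra_neq xy => /ln_inj; apply; rewrite posrE.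
have := expR_gt1Dx l0.
rewrite expRD expRN !lnK ?posrE// ltr_pdivlMr//; lra.
Qed.

Lemma logmix_rising_le A B s r : 0 < s -> s < r -> r < 1 ->
  rising A B s -> rising A B r -> logmix A B s <= logmix A B r.
Proof.
rewrite /rising /logmix => s0 sr r1 ss rr.
have r0 : 0 < r by lra.
have s1 : 0 < 1 - s by lra.
have r1' : 0 < 1 - r by lra.
have h1 : r * (ln s - ln r) < s - r by apply: ln_chord_lt => //; lra.
have h2 : s * (ln r - ln s) < r - s by apply: ln_chord_lt => //; lra.
have h3 : (1 - r) * (ln (1 - s) - ln (1 - r)) < 1 - s - (1 - r)
  by apply: ln_chord_lt => //; lra.
have h4 : (1 - s) * (ln (1 - r) - ln (1 - s)) < 1 - r - (1 - s)
  by apply: ln_chord_lt => //; lra.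
move: (ln s) (ln r) (ln (1 - s)) (ln (1 - r)) h1 h2 h3 h4 => a b c d h1 h2 h3 h4.
have ab : 0 < b - a by nra.
have cd : 0 < c - d by nra.
(* For A, B >= 0 the function is concave, and its tangent at r, rising there, gives the bound. For
   A, B < 0 it is convex and the tangent at s serves. If A >= 0 > B both terms grow; A < 0 <= B
   contradicts [rising]. *)
have [A0|A0] := leP 0 A; have [B0|B0] := leP 0 B.
- suff : 0 <= r * (1 - r) * (A * (b - a) - B * (c - d)) by rewrite pmulr_rge0; [lra|nra].
  have k1 : 0 <= A * (1 - r) * (r * (b - a) - (r - s)) by apply: mulr_ge0; nra.
  have k2 : 0 <= B * r * ((r - s) - (1 - r) * (c - d)) by apply: mulr_ge0; nra.
  have k3 : 0 <= (r - s) * (A * (1 - r) - B * r) by apply: mulr_ge0; lra.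
  lra.
- nra.
- nra.
- suff : 0 <= s * (1 - s) * (A * (b - a) - B * (c - d)) by rewrite pmulr_rge0; [lra|nra].
  have k1 : 0 <= - A * (1 - s) * ((r - s) - s * (b - a)) by apply: mulr_ge0; nra.
  have k2 : 0 <= - B * s * ((1 - s) * (c - d) - (r - s)) by apply: mulr_ge0; nra.
  have k3 : 0 <= (r - s) * (A * (1 - s) - B * s) by apply: mulr_ge0; lra.
  lra.
Qed.

(** A rising point together with A > 0 or B > 0 forces A > 0, so the tangent bound on A ln s is
    strict. *)
Lemma logmix_rising_lt A B s r : 0 < A \/ 0 < B -> 0 < s -> s < r -> r < 1 ->
  rising A B s -> rising A B r -> logmix A B s < logmix A B r.
Proof.
rewrite /rising /logmix => AB s0 sr r1 ss rr.
have r0 : 0 < r by lra.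
have s1 : 0 < 1 - s by lra.
have r1' : 0 < 1 - r by lra.
have h1 : r * (ln s - ln r) < s - r by apply: ln_chord_lt => //; lra.
have h3 : (1 - r) * (ln (1 - s) - ln (1 - r)) < 1 - s - (1 - r)
  by apply: ln_chord_lt => //; lra.
have h4 : (1 - s) * (ln (1 - r) - ln (1 - s)) < 1 - r - (1 - s)
  by apply: ln_chord_lt => //; lra.
move: (ln s) (ln r) (ln (1 - s)) (ln (1 - r)) h1 h3 h4 => a b c d h1 h3 h4.
have A0 : 0 < A by have [//|A0] := ltP 0 A; case: AB => [//|B0]; nra.
have ab : 0 < b - a by nra.
have cd : 0 < c - d by nra.
have [B0|B0] := leP 0 B; last by nra.
suff : 0 < r * (1 - r) * (A * (b - a) - B * (c - d)) by rewrite pmulr_rgt0; [lra|nra].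
have k1 : 0 < A * (1 - r) * (r * (b - a) - (r - s)) by apply: mulr_gt0; nra.
have k2 : 0 <= B * r * ((r - s) - (1 - r) * (c - d)) by apply: mulr_ge0; nra.
have k3 : 0 <= (r - s) * (A * (1 - r) - B * r) by apply: mulr_ge0; lra.
lra.
Qed.

(** The reflection s -> 1-s exchanges A and B, which reduces the falling branch to the rising
    one. *)
Lemma fallingW A B s : rising A B s = false -> rising B A (1 - s).
Proof. by move=> /negbT; rewrite /rising -ltNge; lra. Qed.

Lemma rising_btw A B x y m : x <= m <= y ->
  rising A B x = rising A B y -> rising A B m = rising A B x.
Proof.
rewrite /rising => xmy e.
have [->//|xm] := eqVneq m x.
have [->//|ym] := eqVneq m y.
have {}xm : x < m by lra.
have {}ym : m < y by lra.
case: (leP (B * x)) e => h1 /esym e.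
  by apply/idP; move: e => h2; nra.
by apply/negbTE; move: e => /negbT; rewrite -!ltNge => h2; nra.
Qed.

Lemma logmix_mono A B x y : 0 < x -> x <= y -> y < 1 ->
  rising A B x = rising A B y ->
  if rising A B x then logmix A B x <= logmix A B y
  else logmix A B y <= logmix A B x.
Proof.
move=> x0 xy y1 e; have [<-|nxy] := eqVneq x y; first by rewrite lexx if_same.
have {}xy : x < y by rewrite lt_neqAle nxy.
case: ifP (e) => ex /esym ey; first exact: logmix_rising_le.
rewrite !(logmixC A B); apply: logmix_rising_le; rewrite ?fallingW//; lra.
Qed.

Lemma logmix_inj A B x y : 0 < A \/ 0 < B -> 0 < x < 1 -> 0 < y < 1 ->
  rising A B x = rising A B y -> logmix A B x = logmix A B y -> x = y.
Proof.
move=> AB; wlog xy : x y / x < y.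
  move=> H hx hy e1 e2; have [xy|yx|//] := ltgtP x y; first exact: H.
  by apply/esym; apply: H.
move=> /andP[x0 x1] /andP[y0 y1] e ge; exfalso.
case ex : (rising A B x) (e) => /esym ey.
  by have := logmix_rising_lt AB x0 xy y1 ex ey; rewrite ge ltxx.
have := @logmix_rising_lt B A (1 - y) (1 - x).
rewrite -!(logmixC A B) ge ltxx !fallingW// => H.
suff: false by []; apply: H => //; try lra.
Qed.

Lemma logmix_continuous A B x : 0 < x < 1 -> {for x, continuous (logmix A B)}.
Proof.
move=> /andP[x0 x1]; rewrite /continuous_at /logmix.
apply: cvgD; apply: cvgM; try exact: cvg_cst; first exact: continuous_ln.
apply: (@continuous_comp _ _ _ (fun s => 1 - s) (@ln R)).
  by apply: continuousB; [exact: cst_continuous|].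
by apply: continuous_ln; lra.
Qed.

Lemma logmix_within A B (D : set R) : D `<=` [set x | 0 < x < 1] ->
  {within D, continuous (logmix A B)}.
Proof.
move=> sD; apply: continuous_in_subspaceT => x /set_mem /sD.
exact: logmix_continuous.
Qed.

(** For A > 0 the function tends to minus infinity at 0, so the intermediate value theorem reaches
    every v below the value at z. *)
Lemma logmix_surj_left A B z v : 0 < A -> 0 < z < 1 -> v <= logmix A B z ->
  exists2 z', 0 < z' <= z & logmix A B z' = v.
Proof.
move=> A0 /andP[z0 z1] vz.
(* Chosen so that A ln e = v - |B ln(1-z)|; the subtracted term dominates B ln(1-w) for all w in
   (0,z]. *)
pose e := expR ((v - `|B * ln (1 - z)|) / A).
have e0 : 0 < e by exact: expR_gt0.
pose w := Num.min z e.
have wz : w <= z by rewrite ge_min lexx.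
have w0 : 0 < w by rewrite lt_min z0.
have lw : logmix A B w <= v.
  rewrite /logmix.
  have lnw : A * ln w <= v - `|B * ln (1 - z)|.
    have : ln w <= ln e by rewrite ler_ln ?posrE// ge_min lexx orbT.
    by rewrite /e expRK ler_pdivlMr// mulrC.
  suff : B * ln (1 - w) <= `|B * ln (1 - z)| by lra.
  have l0 : ln (1 - w) <= 0 by apply: ln_le0; lra.
  have lz : ln (1 - z) <= ln (1 - w) by rewrite ler_ln ?posrE; lra.
  have [B0|B0] := leP 0 B; last by have := ler_norm (B * ln (1 - z)); nra.
  have := normr_ge0 (B * ln (1 - z)); nra.
have [||c cwz <-] := @IVT R (logmix A B) w z v wz.
- by apply: logmix_within => x /=; rewrite in_itv/=; lra.
- by rewrite ge_min lw le_max vz orbT.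
- by move: cwz; rewrite in_itv/= => ?; exists c => //; lra.
Qed.

(** A rising point forces A > 0 and its branch descends to minus infinity at 0; a falling point
    forces B > 0 and its branch does so at 1. *)
Lemma logmix_surj A B z v : 0 < A \/ 0 < B -> 0 < z < 1 ->
  v <= logmix A B z ->
  exists z', [/\ 0 < z' < 1, rising A B z' = rising A B z & logmix A B z' = v].
Proof.
move=> AB z01 vz; case ez : (rising A B z).
  have A0 : 0 < A by move: ez; rewrite /rising; case: AB => //; nra.
  have [z' z'z <-] := logmix_surj_left A0 z01 vz.
  exists z'; split => //; first by lra.
  by move: ez; rewrite /rising; nra.
move: ez => /negbT; rewrite /rising -ltNge => ez.
have B0 : 0 < B by case: AB => //; nra.
have z01' : 0 < 1 - z < 1 by lra.
rewrite logmixC in vz.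
have [z' z'z <-] := logmix_surj_left B0 z01' vz.
exists (1 - z'); split; first by lra.
  by apply/negbTE; rewrite -ltNge; nra.
by rewrite [LHS]logmixC; congr logmix; ring.
Qed.

End LogMix.

(** * Arcs in level sets of separated sums, and connectedness inside one box *)

Section Arcs.
Context {R : realType}.
Implicit Types (A B x y z t : R).

Lemma connected_component_arc (T : topologicalType) (Z : set T) (F : R -> T) a b :
  a <= b -> {within `[a, b], continuous F} ->
  (forall x, a <= x <= b -> Z (F x)) -> connected_component Z (F a) (F b).
Proof.
move=> ab cF ZF.
have cI := connected_continuous_connected (@segment_connected R a b) cF.
apply: (connected_component_max _ _ cI).
- by exists a => //=; rewrite in_itv/= lexx.
- by move=> _ [x /= xab <-]; apply: ZF; move: xab; rewrite in_itv.
- by exists b => //=; rewrite in_itv/= lexx ab.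
Qed.

(** While m runs from x to x', the first term is monotone, so the value h(m) required of the second
    term stays between its values at z and z'. On that branch the second term is injective with
    continuous inverse g, and f = g o h. *)
Lemma logmix_level_path A1 B1 A2 B2 t x x' z z' : 0 < A2 \/ 0 < B2 ->
  0 < x -> x <= x' -> x' < 1 -> rising A1 B1 x = rising A1 B1 x' ->
  0 < z < 1 -> 0 < z' < 1 -> rising A2 B2 z = rising A2 B2 z' ->
  logmix A1 B1 x + logmix A2 B2 z = t ->
  logmix A1 B1 x' + logmix A2 B2 z' = t ->
  exists f : R -> R, [/\ {within `[x, x'], continuous f},
    forall m, x <= m <= x' -> 0 < f m < 1 /\ logmix A1 B1 m + logmix A2 B2 (f m) = t,
    f x = z & f x' = z'].
Proof.
move=> AB x0 xx' x1 ex z01 z01' ez tz tz'.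
pose a := Num.min z z'; pose b := Num.max z z'.
have ab : a <= b by rewrite ge_min !le_max lexx.
have a0 : 0 < a by rewrite lt_min; lra.
have b1 : b < 1 by rewrite gt_max; lra.
have ra m : a <= m <= b -> rising A2 B2 m = rising A2 B2 z.
  rewrite /a /b; case: (leP z z') => zz' mab; first exact: rising_btw ez.
  by rewrite ez; apply: rising_btw (esym ez).
have [g gK] : exists g, {in `[a, b], cancel (logmix A2 B2) g}.
  exists (fun v => get [set m | a <= m <= b /\ logmix A2 B2 m = v]).
  move=> m; rewrite in_itv/= => mab.
  case: (@getPex _ [set n | a <= n <= b /\ logmix A2 B2 n = logmix A2 B2 m]).
    by exists m.
  set n := get _ => nab /(logmix_inj AB); apply; rewrite ?ra//; lra.
have kc : {within `[a, b], continuous (logmix A2 B2)}.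
  by apply: logmix_within => m /=; rewrite in_itv/=; lra.
have gc := segment_can_continuous ab kc gK.
pose h m := t - logmix A1 B1 m.
have hab m : x <= m <= x' ->
    Num.min (logmix A2 B2 a) (logmix A2 B2 b) <= h m <=
    Num.max (logmix A2 B2 a) (logmix A2 B2 b).
  move=> mxx.
  have rm := rising_btw mxx ex.
  have m1 : x <= m by lra.
  have m2 : m <= x' by lra.
  have m3 : 0 < m by lra.
  have m4 : m < 1 by lra.
  have := logmix_mono x0 m1 m4 (esym rm).
  have := logmix_mono m3 m2 x1 (etrans rm ex); rewrite rm => H1 H2.
  have hx : h x = logmix A2 B2 z by rewrite /h; lra.
  have hx' : h x' = logmix A2 B2 z' by rewrite /h; lra.
  have : Num.min (h x) (h x') <= h m <= Num.max (h x) (h x').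
    by rewrite /h ge_min le_max; case: (rising _ _ _) H1 H2 => H1 H2; apply/andP; split; apply/orP; by [left; lra|right; lra].
  rewrite hx hx' /a /b minC maxC.
  by case: (leP z z') => _; rewrite // minC maxC.
have hk m : x <= m <= x' -> exists2 n, n \in `[a, b] & logmix A2 B2 n = h m.
  by move=> /hab; apply: IVT.
exists (g \o h); split => /=.
- apply/subspace_continuousP => m /= mx.
  have mx' : x <= m <= x' by move: mx; rewrite in_itv.
  have gm := (subspace_continuousP _ _).1 gc (h m) (hab _ mx').
  apply: cvg_comp gm.
  have hm : h r @[r --> nbhs m] --> h m.
    apply: cvgB; first exact: cvg_cst.
    by apply: logmix_continuous; lra.
  move=> P /hm; rewrite /nbhs/=/within/=.
  have FF : Filter (nbhs m) by exact: nbhs_filter.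
  apply: (@filterS _ _ FF) => r /= Pr rx; apply: Pr.
  by move: rx; rewrite in_itv => /hab.
- move=> m /hk[n nab nh]; rewrite -nh gK//; split; last by rewrite nh /h; lra.
  by move: nab; rewrite in_itv/=; lra.
- rewrite (_ : h x = logmix A2 B2 z) ?gK//; last by rewrite /h; lra.
  by rewrite in_itv/= ge_min le_max !lexx.
- rewrite (_ : h x' = logmix A2 B2 z') ?gK//; last by rewrite /h; lra.
  by rewrite in_itv/= ge_min le_max !lexx !orbT.
Qed.

(** Stated along arbitrary filters with three separate arguments, so that it composes directly with
    arcs and survives permutations of the arguments. *)
Definition jointly_continuous (T : topologicalType) (F : R -> R -> R -> T) :=
  forall (G : set_system R) (u v w : R -> R) x y z, Filter G ->
  0 < x < 1 -> 0 < y < 1 -> 0 < z < 1 ->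
  u @ G --> x -> v @ G --> y -> w @ G --> z ->
  F (u r) (v r) (w r) @[r --> G] --> F x y z.

(** With y frozen, F carries the level path in (x, z) to an arc in Z. *)
Lemma connected_level_step (T : topologicalType) (Z : set T)
    (F : R -> R -> R -> T) A1 B1 A3 B3 t y x x' z z' :
  jointly_continuous F -> 0 < A3 \/ 0 < B3 -> 0 < y < 1 ->
  (forall x z, 0 < x < 1 -> 0 < z < 1 ->
     logmix A1 B1 x + logmix A3 B3 z = t -> Z (F x y z)) ->
  0 < x < 1 -> 0 < x' < 1 -> rising A1 B1 x = rising A1 B1 x' ->
  0 < z < 1 -> 0 < z' < 1 -> rising A3 B3 z = rising A3 B3 z' ->
  logmix A1 B1 x + logmix A3 B3 z = t ->
  logmix A1 B1 x' + logmix A3 B3 z' = t ->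
  connected_component Z (F x y z) (F x' y z').
Proof.
move=> cF AB y01 ZF.
wlog xx' : x x' z z' / x <= x'.
  move=> H hx hx' ex hz hz' ez e e'; have [xx'|/ltW xx'] := leP x x'.
    exact: H.
  by apply: connected_component_sym; apply: H.
move=> x01 x01' ex z01 z01' ez e e'.
have [|||f [cf fP fx fx']] := logmix_level_path (x := x) (x' := x') AB _ _ _ ex z01 z01' ez e e'.
- by lra.
- by lra.
- by lra.
rewrite -fx -fx'.
apply: (@connected_component_arc _ _ (fun r => F r y (f r))) => //.
  apply/subspace_continuousP => m /= mx.
  have mx' : x <= m <= x' by move: mx; rewrite in_itv.
  have {}cf := (subspace_continuousP _ _).1 cf m mx.
  apply: cF => //; [by lra|by have [] := fP _ mx'| |exact: cvg_cst].
  exact: cvg_within.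
by move=> m mx; have [f01 fe] := fP _ mx; apply: ZF => //; lra.
Qed.

Lemma connected_level_box (T : topologicalType) (Z : set T)
    (F : R -> R -> R -> T) A1 B1 A2 B2 A3 B3 t x x' y y' z z' :
  jointly_continuous F -> 0 < A3 \/ 0 < B3 ->
  (forall x y z, 0 < x < 1 -> 0 < y < 1 -> 0 < z < 1 ->
     logmix A1 B1 x + logmix A2 B2 y + logmix A3 B3 z = t -> Z (F x y z)) ->
  0 < x < 1 -> 0 < x' < 1 -> rising A1 B1 x = rising A1 B1 x' ->
  0 < y < 1 -> 0 < y' < 1 -> rising A2 B2 y = rising A2 B2 y' ->
  0 < z < 1 -> 0 < z' < 1 -> rising A3 B3 z = rising A3 B3 z' ->
  logmix A1 B1 x + logmix A2 B2 y + logmix A3 B3 z = t ->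
  logmix A1 B1 x' + logmix A2 B2 y' + logmix A3 B3 z' = t ->
  connected_component Z (F x y z) (F x' y' z').
Proof.
move=> cF AB ZF x01 x01' ex y01 y01' ey z01 z01' ez e e'.
(* Raising the first two terms to their maxima lowers the third one, whose
   range is downward closed. *)
have [X [X01 rX Xx Xx']] : exists X, [/\ 0 < X < 1, rising A1 B1 X = rising A1 B1 x,
    logmix A1 B1 x <= logmix A1 B1 X & logmix A1 B1 x' <= logmix A1 B1 X].
  by have [h|/ltW h] := leP (logmix A1 B1 x) (logmix A1 B1 x'); [exists x'|exists x].
have [Y [Y01 rY Yy Yy']] : exists Y, [/\ 0 < Y < 1, rising A2 B2 Y = rising A2 B2 y,
    logmix A2 B2 y <= logmix A2 B2 Y & logmix A2 B2 y' <= logmix A2 B2 Y].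
  by have [h|/ltW h] := leP (logmix A2 B2 y) (logmix A2 B2 y'); [exists y'|exists y].
have climb x1 y1 z1 : 0 < x1 < 1 -> rising A1 B1 x1 = rising A1 B1 X ->
    0 < y1 < 1 -> rising A2 B2 y1 = rising A2 B2 Y -> 0 < z1 < 1 ->
    logmix A1 B1 x1 <= logmix A1 B1 X -> logmix A2 B2 y1 <= logmix A2 B2 Y ->
    logmix A1 B1 x1 + logmix A2 B2 y1 + logmix A3 B3 z1 = t ->
    exists w, [/\ 0 < w < 1, rising A3 B3 w = rising A3 B3 z1,
      logmix A1 B1 X + logmix A2 B2 Y + logmix A3 B3 w = t &
      connected_component Z (F x1 y1 z1) (F X Y w)].
  move=> x101 rx1 y101 ry1 z101 x1X y1Y e1.
  (* One coordinate moves at a time: v compensates for raising x1 to X at fixed y1, then w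
     compensates for raising y1 to Y at fixed X. *)
  have [|v [v01 rv ev]] := @logmix_surj _ A3 B3 z1 (t - logmix A1 B1 X - logmix A2 B2 y1) AB z101.
    by lra.
  have [|w [w01 rw ew]] := @logmix_surj _ A3 B3 v (t - logmix A1 B1 X - logmix A2 B2 Y) AB v01.
    by lra.
  exists w; split=> //; [by rewrite rw rv|by lra|].
  apply: (@connected_component_trans _ _ (F X y1 v)).
    apply: (@connected_level_step _ _ F A1 B1 A3 B3 (t - logmix A2 B2 y1)) => //; try lra.
    by move=> r s r01 s01 rs; apply: ZF => //; lra.
  apply: (@connected_level_step _ _ (fun a b => F b a) A2 B2 A3 B3 (t - logmix A1 B1 X)) => //; try lra.
    by move=> G u u' u'' ? ? ? ? ? ? ? ? ? ?; exact: cF.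
  by move=> r s r01 s01 rs; apply: ZF => //; lra.
have [w [w01 rw ew cw]] := climb x y z x01 (esym rX) y01 (esym rY) z01 Xx Yy e.
have [||w' [w01' rw' ew' cw']] := climb x' y' z' x01' _ y01' _ z01' Xx' Yy' e'.
- by rewrite rX ex.
- by rewrite rY ey.
(* Both climbs end over the same (X, Y), so the third terms agree; w and w' lie on one branch, where
   the term is injective. *)
have ww' : w = w' by apply: (logmix_inj AB w01 w01'); rewrite ?rw ?rw'//; lra.
by apply: connected_component_trans cw _; rewrite ww'; apply: connected_component_sym.
Qed.

End Arcs.

(** * Counting components through a chart by the open cube *)

Section Counting.
Context {R : realType}.

(** Points of Z with equal code share a component, so sending k to the component of any point with
    code k defines a surjection from codes to components. *)
Lemma noncompact_components_card (T : topologicalType) (Z : set T) (n : nat)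
    (code : T -> nat) : (forall p, (code p < n)%N) ->
  (forall p q, Z p -> Z q -> code p = code q -> connected_component Z p q) ->
  noncompact_components Z #<= `I_n.
Proof.
move=> code_lt codeP; apply/pcard_surjP.
pose rep k C := exists p, [/\ Z p, C = connected_component Z p & code p = k].
exists (fun k => get (rep k)) => C [[p Zp Cp] _].
exists (code p) => /=; first exact: code_lt.
have [] := @getPex _ (rep (code p)); first by exists C, p.
move=> q [Zq -> qp]; rewrite Cp; apply/same_connected_component.
exact: codeP.
Qed.

Definition level_chart (T : topologicalType) (Z : set T)
    (F : R -> R -> R -> T) A1 B1 A2 B2 A3 B3 t :=
  [/\ jointly_continuous F,
    forall x y z, 0 < x < 1 -> 0 < y < 1 -> 0 < z < 1 ->
      logmix A1 B1 x + logmix A2 B2 y + logmix A3 B3 z = t -> Z (F x y z) &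
    forall p, Z p -> exists x y z, [/\ 0 < x < 1, 0 < y < 1, 0 < z < 1,
      logmix A1 B1 x + logmix A2 B2 y + logmix A3 B3 z = t & F x y z = p]].

Lemma level_chart_card_pos (T : topologicalType) (Z : set T) F
    (A1 B1 A2 B2 A3 B3 t : R) :
  level_chart Z F A1 B1 A2 B2 A3 B3 t -> 0 < A3 \/ 0 < B3 ->
  noncompact_components Z #<= `I_8.
Proof.
move=> [cF ZF FZ] AB.
pose coord p := get [set u : R * R * R | [/\ 0 < u.1.1 < 1, 0 < u.1.2 < 1,
  0 < u.2 < 1, logmix A1 B1 u.1.1 + logmix A2 B2 u.1.2 + logmix A3 B3 u.2 = t &
  F u.1.1 u.1.2 u.2 = p]].
(* The monotonicity bits of the chosen preimage, read as a binary number below 8, name its box. *)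
pose code p := (rising A1 B1 (coord p).1.1 + 2 * rising A2 B2 (coord p).1.2 +
  4 * rising A3 B3 (coord p).2)%N.
apply: (@noncompact_components_card _ _ _ code).
  by move=> p; rewrite /code; do 3 case: rising.
have coordP p : Z p -> _ := fun Zp => @getPex _ [set u : R * R * R |
  [/\ 0 < u.1.1 < 1, 0 < u.1.2 < 1, 0 < u.2 < 1,
  logmix A1 B1 u.1.1 + logmix A2 B2 u.1.2 + logmix A3 B3 u.2 = t &
  F u.1.1 u.1.2 u.2 = p]] (let: ex_intro x (ex_intro y (ex_intro z H)) := FZ p Zp in
  ex_intro _ (x, y, z) H).
move=> p q /coordP; rewrite -/(coord p) => -[p1 p2 p3 ep Fp].
move=> /coordP; rewrite -/(coord q) => -[q1 q2 q3 eq Fq] pq.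
rewrite -Fp -Fq.
apply: (connected_level_box cF AB ZF) => //; move: pq; rewrite /code;
  by do 6 case: rising.
Qed.

Lemma level_chartN (T : topologicalType) (Z : set T) F
    (A1 B1 A2 B2 A3 B3 t : R) :
  level_chart Z F A1 B1 A2 B2 A3 B3 t ->
  level_chart Z F (- A1) (- B1) (- A2) (- B2) (- A3) (- B3) (- t).
Proof.
move=> [cF ZF FZ]; split=> //.
  by move=> x y z x01 y01 z01; rewrite !logmixN => e; apply: ZF => //; lra.
move=> p /FZ[x [y [z [x01 y01 z01 e Fp]]]].
by exists x, y, z; split=> //; rewrite !logmixN; lra.
Qed.

Lemma level_chart_card3 (T : topologicalType) (Z : set T) F
    (A1 B1 A2 B2 A3 B3 t : R) :
  level_chart Z F A1 B1 A2 B2 A3 B3 t -> A3 != 0 \/ B3 != 0 ->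
  noncompact_components Z #<= `I_8.
Proof.
move=> ch AB; have [AB0|AB0] : (0 < A3 \/ 0 < B3) \/ (0 < - A3 \/ 0 < - B3).
- by case: AB => /lt_total /orP[]; lra.
- exact: level_chart_card_pos ch AB0.
- exact: level_chart_card_pos (level_chartN ch) AB0.
Qed.

Lemma level_chart_rot (T : topologicalType) (Z : set T) F
    (A1 B1 A2 B2 A3 B3 t : R) :
  level_chart Z F A1 B1 A2 B2 A3 B3 t ->
  level_chart Z (fun y z x => F x y z) A2 B2 A3 B3 A1 B1 t.
Proof.
move=> [cF ZF FZ]; split.
- by move=> G u v w x y z FG x01 y01 z01 ux vy wz; apply: cF.
- by move=> x y z x01 y01 z01 e; apply: ZF => //; lra.
- move=> p /FZ[x [y [z [x01 y01 z01 e Fp]]]].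
  by exists y, z, x; split=> //; lra.
Qed.

(** The box argument wants a positive coefficient in the third term. Rotating the coordinates moves
    a nonzero pair there, and negating the level equation corrects the sign. *)
Lemma level_chart_card (T : topologicalType) (Z : set T) F
    (A1 B1 A2 B2 A3 B3 t : R) :
  level_chart Z F A1 B1 A2 B2 A3 B3 t ->
  ~ [/\ A1 = 0 /\ B1 = 0, A2 = 0 /\ B2 = 0 & A3 = 0 /\ B3 = 0] ->
  noncompact_components Z #<= `I_8.
Proof.
move=> ch nz.
have eq0 (a b : R) : ~~ ((a != 0) || (b != 0)) -> a = 0 /\ b = 0.
  by rewrite negb_or !negbK => /andP[/eqP -> /eqP ->].
have [/orP h|/eq0 h3] := boolP ((A3 != 0) || (B3 != 0)).
  exact: level_chart_card3 ch h.
have [/orP h|/eq0 h1] := boolP ((A1 != 0) || (B1 != 0)).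
  exact: level_chart_card3 (level_chart_rot ch) h.
have [/orP h|/eq0 h2] := boolP ((A2 != 0) || (B2 != 0)).
  exact: level_chart_card3 (level_chart_rot (level_chart_rot ch)) h.
by exfalso; apply: nz.
Qed.

Lemma cvg_row (n : nat) (G : set_system R) (f : R -> 'rV[R]_n) (l : 'rV[R]_n) :
  Filter G -> (forall j, f r 0 j @[r --> G] --> l 0 j) -> f @ G --> l.
Proof.
move=> FG fl P [Q lQ QP].
have : \forall r \near G, forall j, Q 0 j (f r 0 j).
  by apply: filter_forall => j; exact: fl.
apply: filterS => r Qr; apply: QP => i j.
by rewrite !ord1.
Qed.

Lemma exp_logmix_continuous (n : nat) (k P1 Q1 P2 Q2 P3 Q3 : 'I_n -> R) :
  jointly_continuous (fun x y z => \row_j expR (k j + logmix (P1 j) (Q1 j) x +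
    logmix (P2 j) (Q2 j) y + logmix (P3 j) (Q3 j) z)).
Proof.
move=> G u v w x y z FG x01 y01 z01 ux vy wz; apply: cvg_row => j.
rewrite mxE; under eq_fun do rewrite mxE.
apply: continuous_cvg; first exact: continuous_expR.
apply: cvgD; first apply: cvgD; first apply: cvgD; first exact: cvg_cst.
- exact: cvg_comp ux (logmix_continuous x01).
- exact: cvg_comp vy (logmix_continuous y01).
- exact: cvg_comp wz (logmix_continuous z01).
Qed.

End Counting.

(** * Parametrising the positive solutions of a signed sum of five terms *)

Section SignCharts.
Context {R : realType}.

Lemma logmix_sum (m : nat) (l e f : 'I_m -> R) x :
  \sum_i l i * logmix (e i) (f i) x =
  logmix (\sum_i l i * e i) (\sum_i l i * f i) x.
Proof.
rewrite /logmix !mulr_suml -big_split/=.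
by apply: eq_bigr => i _; ring.
Qed.

Lemma sum5 (F : 'I_5 -> R) : \sum_i F i =
  F (@Ordinal 5 0 isT) + F (@Ordinal 5 1 isT) + F (@Ordinal 5 2 isT) +
  F (@Ordinal 5 3 isT) + F (@Ordinal 5 4 isT).
Proof.
rewrite !big_ord_recl big_ord0 addr0 !addrA.
by do 4?[congr (_ + _)]; congr F; apply: val_inj.
Qed.

Lemma forall5 (P : 'I_5 -> Prop) :
  P (@Ordinal 5 0 isT) -> P (@Ordinal 5 1 isT) -> P (@Ordinal 5 2 isT) ->
  P (@Ordinal 5 3 isT) -> P (@Ordinal 5 4 isT) -> forall i, P i.
Proof.
move=> P0 P1 P2 P3 P4 [[|[|[|[|[|//]]]]] h].
all: by rewrite (bool_irrelevance h isT).
Qed.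

(** The data depend on the signs s alone. Up to the factor exp(m), the solutions are u_i = x^(e1 i)
    (1-x)^(f1 i) y^(e2 i) (1-y)^(f2 i) z^(e3 i) (1-z)^(f3 i). The last clause says that the all-ones
    vector and the six exponent vectors span R^5; it keeps the separated equation from being
    constant. *)
Definition sign_chart (s e1 f1 e2 f2 e3 f3 : 'I_5 -> R) :=
  [/\ forall x y z, 0 < x < 1 -> 0 < y < 1 -> 0 < z < 1 ->
        \sum_i s i * expR (logmix (e1 i) (f1 i) x + logmix (e2 i) (f2 i) y +
                           logmix (e3 i) (f3 i) z) = 0,
      forall u : 'I_5 -> R, (forall i, 0 < u i) -> \sum_i s i * u i = 0 ->
        exists x y z m, [/\ 0 < x < 1, 0 < y < 1, 0 < z < 1 &
          forall i, ln (u i) = m + (logmix (e1 i) (f1 i) x +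
            logmix (e2 i) (f2 i) y + logmix (e3 i) (f3 i) z)] &
      forall l : 'I_5 -> R, \sum_i l i = 0 ->
        \sum_i l i * e1 i = 0 -> \sum_i l i * f1 i = 0 ->
        \sum_i l i * e2 i = 0 -> \sum_i l i * f2 i = 0 ->
        \sum_i l i * e3 i = 0 -> \sum_i l i * f3 i = 0 -> forall i, l i = 0].

Lemma ln_ratio (a b : R) : 0 < a -> 0 < b ->
  [/\ 0 < a / (a + b) < 1, ln (a / (a + b)) = ln a - ln (a + b) &
      ln (1 - a / (a + b)) = ln b - ln (a + b)].
Proof.
move=> a0 b0; have ab : 0 < a + b by lra.
rewrite (_ : 1 - a / (a + b) = b / (a + b)); last by field; lra.
split; last 2 first; try by rewrite ln_div ?posrE.
by rewrite divr_gt0// ltr_pdivrMr//; lra.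
Qed.

Notation tab l := (fun i : 'I_5 => nth 0 l i).

(* Three terms of one sign and two of the other: after normalising both sums
   to [1], the terms are [x, (1-x)y, (1-x)(1-y)] and [z, 1-z]. *)
Lemma sign_chart32 : sign_chart (fun i : 'I_5 => if (i < 3)%N then 1 else -1)
  (tab [:: 1; 0; 0; 0; 0]) (tab [:: 0; 1; 1; 0; 0])
  (tab [:: 0; 1; 0; 0; 0]) (tab [:: 0; 0; 1; 0; 0])
  (tab [:: 0; 0; 0; 1; 0]) (tab [:: 0; 0; 0; 0; 1]).
Proof.
split.
- move=> x y z x01 y01 z01; rewrite sum5/= /logmix.
  rewrite !(mul0r, mul1r, add0r, addr0) !expRD !lnK ?posrE; lra.
- move=> u u0; rewrite sum5/= => us.
  set u1 := u (@Ordinal 5 0 isT) in us *; set u2 := u (@Ordinal 5 1 isT) in us *.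
  set u3 := u (@Ordinal 5 2 isT) in us *; set u4 := u (@Ordinal 5 3 isT) in us *.
  set u5 := u (@Ordinal 5 4 isT) in us *.
  have h1 : 0 < u1 by apply: u0. have h2 : 0 < u2 by apply: u0.
  have h3 : 0 < u3 by apply: u0. have h4 : 0 < u4 by apply: u0.
  have h5 : 0 < u5 by apply: u0.
  have [x01 lx lx'] := ln_ratio h1 (addr_gt0 h2 h3).
  have [y01 ly ly'] := ln_ratio h2 h3.
  have [z01 lz lz'] := ln_ratio h4 h5.
  (* Each coordinate is the share of one term in the part of its sum still to be split; m below is
     the logarithm of the common value of both sums. *)
  exists (u1 / (u1 + (u2 + u3))), (u2 / (u2 + u3)), (u4 / (u4 + u5)).
  exists (ln (u4 + u5)); split=> //.
  have e : u1 + (u2 + u3) = u4 + u5 by lra.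
  apply: forall5; rewrite /= /logmix ?lx ?lx' ?ly ?ly' ?lz ?lz' ?e -/u1 -/u2 -/u3 -/u4 -/u5; lra.
- move=> l; rewrite !sum5/= => *; apply: (@forall5 (fun i => l i = 0)); lra.
Qed.

(* Four terms of one sign and one of the other: after normalising the latter
   to [1], the former are [x, (1-x)y, (1-x)(1-y)z, (1-x)(1-y)(1-z)]. *)
Lemma sign_chart41 : sign_chart (fun i : 'I_5 => if (i < 4)%N then 1 else -1)
  (tab [:: 1; 0; 0; 0; 0]) (tab [:: 0; 1; 1; 1; 0])
  (tab [:: 0; 1; 0; 0; 0]) (tab [:: 0; 0; 1; 1; 0])
  (tab [:: 0; 0; 1; 0; 0]) (tab [:: 0; 0; 0; 1; 0]).
Proof.
split.
- move=> x y z x01 y01 z01; rewrite sum5/= /logmix.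
  rewrite !(mul0r, mul1r, add0r, addr0) !expRD !lnK ?posrE ?expR0; lra.
- move=> u u0; rewrite sum5/= => us.
  set u1 := u (@Ordinal 5 0 isT) in us *; set u2 := u (@Ordinal 5 1 isT) in us *.
  set u3 := u (@Ordinal 5 2 isT) in us *; set u4 := u (@Ordinal 5 3 isT) in us *.
  set u5 := u (@Ordinal 5 4 isT) in us *.
  have h1 : 0 < u1 by apply: u0. have h2 : 0 < u2 by apply: u0.
  have h3 : 0 < u3 by apply: u0. have h4 : 0 < u4 by apply: u0.
  have [x01 lx lx'] := ln_ratio h1 (addr_gt0 h2 (addr_gt0 h3 h4)).
  have [y01 ly ly'] := ln_ratio h2 (addr_gt0 h3 h4).
  have [z01 lz lz'] := ln_ratio h3 h4.
  exists (u1 / (u1 + (u2 + (u3 + u4)))), (u2 / (u2 + (u3 + u4))), (u3 / (u3 + u4)).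
  exists (ln u5); split=> //.
  have e : u1 + (u2 + (u3 + u4)) = u5 by lra.
  apply: forall5; rewrite /= /logmix ?lx ?lx' ?ly ?ly' ?lz ?lz' ?e -/u1 -/u2 -/u3 -/u4 -/u5; lra.
- move=> l; rewrite !sum5/= => *; apply: (@forall5 (fun i => l i = 0)); lra.
Qed.

End SignCharts.

(** * The affine dependency among the exponents *)

Section AffineDependency.
Context {R : realType}.

(** The exponents in homogeneous coordinates (a_i, 1): left kernel vectors are exactly the affine
    dependencies. *)
Definition homogeneous_mx (m n : nat) (a : 'I_m -> 'rV[R]_n) : 'M[R]_(m, n + 1) :=
  row_mx (\matrix_(i, j) a i 0 j) (const_mx 1).

(** The set H of x with x.b = r is convex, and affine as a translate of a kernel, so it contains the
    hull and its affine span, the whole space. Testing H at 0 and at b gives |b|^2 = r = 0. *)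
Lemma newton_polytope_full_not_in_hyperplane (m n : nat) (a : 'I_m.+1 -> 'rV[R]_n)
    (b : 'rV[R]_n) (r : R) :
  has_affine_dim (newton_polytope a) n ->
  (forall i, (a i *m b^T) 0 0 = r) -> b = 0.
Proof.
move=> [p [V [dV sV]]] ab.
pose H := [set x : 'rV[R]_n | (x *m b^T) 0 0 = r].
have HT : [set: 'rV[R]_n] `<=` H.
  have VT : V = fullv.
    by apply/eqP; rewrite eqEdim subvf dV dimvf /dim/= mul1n leqnn.
  have -> : [set: 'rV[R]_n] = affine_span (newton_polytope a).
    rewrite sV; apply/seteqP; split=> // x _ /=.
    by exists (x - p); [rewrite /= VT memvf|rewrite addrC subrK].
  apply: smallest_sub.
    exists (\dim (lker (linfun (mulmxr b^T) : 'Hom('rV[R]_n, 'M[R]_(1, 1))))).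
    exists (a ord0), (lker (linfun (mulmxr b^T) : 'Hom('rV[R]_n, 'M[R]_(1, 1)))).
    split=> //; apply/seteqP; split=> x /=.
      move=> Hx; exists (x - a ord0); last by rewrite addrC subrK.
      rewrite /= memv_ker lfunE/= mulmxBl; apply/eqP/matrixP => i j.
      by rewrite !ord1 !mxE; have := ab ord0; move: Hx; rewrite /H/= !mxE => -> ->; rewrite subrr.
    move=> [v vk <-]; move: vk; rewrite /= memv_ker lfunE/= => /eqP vk.
    by rewrite /H/= mulmxDl vk addr0 ab.
  apply: smallest_sub.
    move=> x y k /set_mem Hx /set_mem Hy; apply/mem_set.
    rewrite /H/= in Hx Hy *.
    rewrite mulmxDl -!scalemxAl mxE [X in X + _]mxE [X in _ + X]mxE Hx Hy.
    by rewrite -mulrDl unstable.add_onemK mul1r.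
  by move=> _ [i _ <-]; exact: ab.
have := HT 0 I; rewrite /H/= mul0mx mxE => r0.
have := HT b I; rewrite /H/= -r0 mxE.
under eq_bigr do rewrite mxE -expr2.
move=> /eqP; rewrite psumr_eq0; last by move=> *; exact: sqr_ge0.
move=> /allP b0; apply/rowP => j; rewrite mxE.
by have := b0 j; rewrite mem_index_enum sqrf_eq0 => /(_ isT)/eqP.
Qed.

(** A relation (b, r) between the columns reads a_i.b = -r for all i, so b = 0 and then r = 0. *)
Lemma newton_polytope_full_row_full (m n : nat) (a : 'I_m.+1 -> 'rV[R]_n) :
  has_affine_dim (newton_polytope a) n -> row_full (homogeneous_mx a).
Proof.
move=> dimN; suff : row_free (homogeneous_mx a)^T.
  by rewrite /row_free /row_full mxrank_tr.
rewrite -kermx_eq0; apply/rowV0P => v /sub_kermxP.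
rewrite -[v]hsubmxK; set b := lsubmx v; set r := rsubmx v.
rewrite /homogeneous_mx tr_row_mx mul_row_col => vM.
have abr i : (a i *m b^T) 0 0 = - r 0 0.
  have /matrixP/(_ 0 i) := vM.
  rewrite !mxE big_ord1 !mxE mulr1 => e.
  apply/eqP; rewrite -addr_eq0; apply/eqP; apply: etrans e; congr (_ + _).
  by apply: eq_bigr => j _; rewrite !mxE mulrC.
have b0 := newton_polytope_full_not_in_hyperplane dimN abr.
have : r = 0.
  apply/matrixP => i j; rewrite !ord1 [RHS]mxE; have := abr ord0.
  by rewrite b0 trmx0 mulmx0 mxE => /esym/eqP; rewrite oppr_eq0 => /eqP ->.
by rewrite b0 => ->; rewrite row_mx0.
Qed.

(** The left kernel of M is a line, spanned by l. Since L is a left inverse, the rows of 1 - ML lie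
    in that kernel and are multiples of l; hence l w = 0 makes M(Lw) = w. *)
Lemma corank1_solve (F : fieldType) (n : nat) (M : 'M[F]_(n.+1, n)) :
  row_full M -> exists (l : 'rV[F]_n.+1) (L : 'M[F]_(n, n.+1)),
    [/\ l != 0, l *m M = 0, L *m M = 1%:M &
        forall w : 'cV[F]_n.+1, l *m w = 0 -> M *m (L *m w) = w].
Proof.
move=> fM; have [L LM] := row_fullP fM.
have rK : \rank (kermx M) = 1%N by rewrite mxrank_ker (eqP fM) subSnn.
pose l := nz_row (kermx M).
have l0 : l != 0 by rewrite nz_row_eq0 -mxrank_eq0 rK.
have lK : (l <= kermx M)%MS := nz_row_sub _.
have Kl : (kermx M <= l)%MS.
  by rewrite -(mxrank_leqif_sup lK) rank_rV l0 rK.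
exists l, L; split=> //; first exact/sub_kermxP.
move=> w lw.
have : (1%:M - M *m L <= l)%MS.
  apply: submx_trans Kl; apply/sub_kermxP.
  by rewrite mulmxBl mul1mx -mulmxA LM mulmx1 subrr.
move=> /submxP[D eD]; have : (1%:M - M *m L) *m w = 0 by rewrite eD -mulmxA lw mulmx0.
by rewrite mulmxBl mul1mx -mulmxA => /eqP; rewrite subr_eq0 => /eqP.
Qed.

End AffineDependency.

(** * From nomials to charts, and reduction to sorted signs *)

Section Nomials.
Context {R : realType}.

Lemma monomialE (n : nat) (x b : 'rV[R]_n) : pos_orthant x ->
  monomial x b = expR (\sum_j b 0 j * ln (x 0 j)).
Proof.
move=> x0; rewrite /monomial expR_sum; apply: eq_bigr => j _.
by rewrite /powR gt_eqF//; exact: x0.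
Qed.

Lemma homogeneous_mxE (n m : nat) (a : 'I_m -> 'rV[R]_n) (v : 'cV[R]_(n + 1)) i :
  (homogeneous_mx a *m v) i 0 =
  \sum_j a i 0 j * v (lshift 1 j) 0 + v (rshift n 0) 0.
Proof.
rewrite -[v in LHS]vsubmxK /homogeneous_mx mul_row_col mxE; congr (_ + _).
  by rewrite mxE; apply: eq_bigr => j _; rewrite !mxE.
by rewrite mxE big_ord1 !mxE mul1r.
Qed.

(** Taking logarithms, p in Z corresponds to (x, y, z) when M v = W, where M is [homogeneous_mx a],
    v = (ln p, -m) and m is the scale. This is solvable exactly when l W = 0, which is the separated
    level equation, and then v = L W. *)
Lemma nomial_card_of_sign_chart (c : 'I_5 -> R) (a : 'I_5 -> 'rV[R]_3) f
    (s e1 f1 e2 f2 e3 f3 : 'I_5 -> R) :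
  is_nomial c a f -> has_affine_dim (newton_polytope a) 3 ->
  (forall i, c i = s i * `|c i|) -> sign_chart s e1 f1 e2 f2 e3 f3 ->
  noncompact_components (zero_set f) #<= `I_8.
Proof.
move=> [c0 _ fE] dimN cs [sum0 surj indep].
have [l [L [l0 lM LM solve]]] := corank1_solve (newton_polytope_full_row_full dimN).
have nc i : 0 < `|c i| by rewrite normr_gt0.
pose lnu i x y z := logmix (e1 i) (f1 i) x + logmix (e2 i) (f2 i) y + logmix (e3 i) (f3 i) z.
pose W x y z : 'cV[R]_5 := \col_i (lnu i x y z - ln `|c i|).
have sumW (w : 'I_5 -> R) x y z : \sum_i w i * W x y z i 0 =
    - (\sum_i w i * ln `|c i|) +
    logmix (\sum_i w i * e1 i) (\sum_i w i * f1 i) x +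
    logmix (\sum_i w i * e2 i) (\sum_i w i * f2 i) y +
    logmix (\sum_i w i * e3 i) (\sum_i w i * f3 i) z.
  rewrite -!logmix_sum -sumrN -!big_split/=; apply: eq_bigr => i _.
  by rewrite mxE /lnu; ring.
pose P (e : 'I_5 -> R) j := \sum_i L (@lshift 3 1 j) i * e i.
(* The exponential of the first three coordinates of L W, expanded into separated sums so that
   continuity is visible. *)
pose F x y z : 'rV[R]_3 := \row_j expR (- P (fun i => ln `|c i|) j +
  logmix (P e1 j) (P f1 j) x + logmix (P e2 j) (P f2 j) y +
  logmix (P e3 j) (P f3 j) z).
have FE x y z j : F x y z 0 j = expR ((L *m W x y z) (@lshift 3 1 j) 0).
  by rewrite !mxE sumW.
have eqW x y z : logmix (\sum_i l 0 i * e1 i) (\sum_i l 0 i * f1 i) x +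
    logmix (\sum_i l 0 i * e2 i) (\sum_i l 0 i * f2 i) y +
    logmix (\sum_i l 0 i * e3 i) (\sum_i l 0 i * f3 i) z =
      \sum_i l 0 i * ln `|c i| <-> l *m W x y z = 0.
  have e : (l *m W x y z) 0 0 = \sum_i l 0 i * W x y z i 0 by rewrite mxE.
  rewrite sumW in e; split=> h.
    by apply/matrixP => i j; rewrite !ord1 e [RHS]mxE; lra.
  by move: e; rewrite h mxE; lra.
apply: (@level_chart_card _ _ _ F (\sum_i l 0 i * e1 i) (\sum_i l 0 i * f1 i)
  (\sum_i l 0 i * e2 i) (\sum_i l 0 i * f2 i) (\sum_i l 0 i * e3 i)
  (\sum_i l 0 i * f3 i) (\sum_i l 0 i * ln `|c i|)); last first.
  (* If all six coefficients vanished, l would annihilate the six exponent vectors, and also the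
     all-ones vector by the last column of l M = 0; then l = 0. *)
  move=> [[A1 B1] [A2 B2] [A3 B3]]; move/eqP : l0; apply.
  apply/rowP => i; rewrite mxE; apply: indep => //.
  have : (l *m homogeneous_mx a) 0 (@rshift 3 1 0) = 0 by rewrite lM mxE.
  rewrite mxE => e; rewrite -[RHS]e.
  by apply: eq_bigr => k _; rewrite /homogeneous_mx row_mxEr mxE mulr1.
split.
- exact: exp_logmix_continuous.
- move=> x y z x01 y01 z01 /eqW/solve MW.
  have F0 : pos_orthant (F x y z) by move=> j; rewrite FE expR_gt0.
  split=> //=; rewrite fE//.
  set v := L *m W x y z in MW FE.
  (* The last coordinate of v only multiplies all terms by a common factor. *)
  transitivity ((\sum_i s i * expR (lnu i x y z)) * expR (- v (rshift 3 0) 0)).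
    rewrite mulr_suml; apply: eq_bigr => i _.
    rewrite monomialE// cs -!mulrA -expRD; congr (_ * _).
    rewrite -[X in X * _]lnK ?posrE// -expRD; congr expR.
    have WE : W x y z i 0 = lnu i x y z - ln `|c i| by rewrite mxE.
    have /matrixP/(_ i 0) := MW; rewrite (@homogeneous_mxE 3 5 a v i) WE => e.
    have -> : \sum_j a i 0 j * ln (F x y z 0 j) = \sum_j a i 0 j * v (@lshift 3 1 j) 0.
      by apply: eq_bigr => j _; rewrite FE expRK.
    lra.
  by rewrite /lnu sum0// mul0r.
- move=> p [p0 /= fp].
  have [||x [y [z [m [x01 y01 z01 um]]]]] := surj (fun i => `|c i| * monomial p (a i)).
  + by move=> i; rewrite mulr_gt0// monomialE// expR_gt0.
  + by apply: etrans fp; rewrite fE//; apply: eq_bigr => i _; rewrite mulrA -cs.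
  pose v : 'cV[R]_(3 + 1) := col_mx (\col_j ln (p 0 j)) (const_mx (- m)).
  have vl j : v (@lshift 3 1 j) 0 = ln (p 0 j) by rewrite col_mxEu mxE.
  have vr : v (@rshift 3 1 0) 0 = - m by rewrite col_mxEd mxE.
  have MW : homogeneous_mx a *m v = W x y z.
    apply/matrixP => i j; rewrite !ord1 (@homogeneous_mxE 3 5 a v i) vr.
    under eq_bigr do rewrite vl.
    rewrite mxE /lnu; have := um i; rewrite monomialE// lnM ?posrE ?expR_gt0// expRK; lra.
  exists x, y, z; split=> //.
    by apply/eqW; rewrite -MW mulmxA lM mul0mx.
  apply/rowP => j; rewrite FE -MW mulmxA LM mul1mx vl lnK ?posrE//.
Qed.

(** Three or four positive terms are covered by the two sign charts; with five, f is positive on the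
    orthant and the zero set is empty. *)
Lemma nomial_card_sorted (c : 'I_5 -> R) (a : 'I_5 -> 'rV[R]_3) f (p : nat) :
  is_nomial c a f -> has_affine_dim (newton_polytope a) 3 ->
  (3 <= p <= 5)%N -> (forall i, (0 < c i) = (i < p)%N) ->
  noncompact_components (zero_set f) #<= `I_8.
Proof.
move=> fN dimN p35 cp.
have [c0 _ fE] := fN.
have cs i : c i = (if (i < p)%N then 1 else -1) * `|c i|.
  rewrite -cp; have [ci|ci] := ltP 0 (c i); first by rewrite gtr0_norm// mul1r.
  by rewrite ler0_norm// mulN1r opprK.
have [p3|[p4|p5]] : p = 3%N \/ p = 4%N \/ p = 5%N by lia.
- rewrite p3 in cs; exact: nomial_card_of_sign_chart fN dimN cs sign_chart32.
- rewrite p4 in cs; exact: nomial_card_of_sign_chart fN dimN cs sign_chart41.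
- suff -> : noncompact_components (zero_set f) = set0 by exact: card_ge0.
  apply/seteqP; split=> // C [[x [x0 /= fx] _] _].
  have : 0 < f x; last by rewrite fx ltxx.
  rewrite fE// big_ord_recl; apply: ltr_pwDl.
    by rewrite mulr_gt0 ?cp ?p5// monomialE// expR_gt0.
  apply: sumr_ge0 => i _; rewrite mulr_ge0//.
    by rewrite ltW// cp p5 ltn_ord.
  by rewrite monomialE// expR_ge0.
Qed.

Lemma is_nomial_perm (m n : nat) (c : 'I_m -> R) (a : 'I_m -> 'rV[R]_n) f
    (s : {perm 'I_m}) : is_nomial c a f -> is_nomial (c \o s) (a \o s) f.
Proof.
move=> [c0 ai fE]; split => [i|i j /ai/perm_inj//|x x0]; first exact: c0.
by rewrite fE// (reindex_inj (@perm_inj _ s)).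
Qed.

Lemma is_nomialN (m n : nat) (c : 'I_m -> R) (a : 'I_m -> 'rV[R]_n) f :
  is_nomial c a f -> is_nomial (fun i => - c i) a (fun x => - f x).
Proof.
move=> [c0 ai fE]; split => // [i|x x0]; first by rewrite oppr_eq0.
by rewrite fE// -sumrN; apply: eq_bigr => i _; rewrite mulNr.
Qed.

(** List the elements of P first and the others after them; s sends i to the i-th entry. *)
Lemma sort_perm (m : nat) (P : pred 'I_m) :
  exists s : {perm 'I_m}, forall i, P (s i) = (i < #|P|)%N.
Proof.
pose e := enum P ++ enum (predC P).
have se : size e = m by rewrite size_cat -!cardE cardC card_ord.
have ue : uniq e.
  rewrite cat_uniq !enum_uniq andbT/=; apply/hasPn => i.
  by rewrite !mem_enum.
have nth_inj : injective (fun i : 'I_m => nth i e i).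
  move=> i j; rewrite (set_nth_default i j) ?se// => /eqP.
  by rewrite nth_uniq ?se// => /eqP/val_inj.
exists (perm nth_inj) => i; rewrite permE nth_cat -cardE.
case: ltnP => h.
  by have := mem_nth i (s := enum P) (n := i); rewrite -cardE h mem_enum => /(_ isT).
apply/negbTE; have := mem_nth i (s := enum (predC P)) (n := i - #|P|).
rewrite -cardE mem_enum; apply.
by rewrite ltn_subLR// cardC card_ord.
Qed.

Lemma nomial_card (c : 'I_5 -> R) (a : 'I_5 -> 'rV[R]_3) f :
  is_nomial c a f -> has_affine_dim (newton_polytope a) 3 ->
  noncompact_components (zero_set f) #<= `I_8.
Proof.
(* One of the two signs occurs at least three times among five, and passing from f to -f keeps the
   zero set. *)
wlog P3 : c f / (3 <= #|[pred i | (0 < c i)%R]|)%N.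
  move=> H fN dimN; have [|P2] := leqP 3 #|[pred i | (0 < c i)%R]|; first by move/H; apply.
  have -> : zero_set f = zero_set (fun x => - f x).
    by apply/seteqP; split=> x [x0 /= fx]; split=> //=;
      [rewrite fx oppr0|apply/eqP; rewrite -oppr_eq0 fx].
  apply: (H (fun i => - c i)) => //; last exact: is_nomialN.
  have := cardC [pred i | 0 < c i]; rewrite card_ord.
  rewrite (@eq_card _ [predC _] [pred i | 0 < - c i]); last first.
    move=> i; rewrite !inE oppr_gt0 -leNgt le_eqVlt.
    by have [/(_ i)/negbTE -> _ _] := fN.
  have arith k l : (k + l = 5 -> k < 3 -> 2 < l)%N by lia.
  by move/arith; apply.
move=> fN dimN; have [s cs] := sort_perm [pred i | 0 < c i].
apply: (@nomial_card_sorted (c \o s) (a \o s) f #|[pred i | 0 < c i]|).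
- exact: is_nomial_perm.
- rewrite /newton_polytope (_ : range (a \o s) = range a)//.
  apply/seteqP; split=> _ [i _ <-]; first by exists (s i).
  by exists ((s^-1)%g i) => //=; rewrite permKV.
- by rewrite P3 -[leqRHS]card_ord max_card.
- exact: cs.
Qed.

End Nomials.

Unset Implicit Arguments.

Theorem theorem5 (R : realType) (c : 'I_5 -> R) (a : 'I_5 -> 'rV[R]_3)
    (f : 'rV[R]_3 -> R) :
  is_nomial c a f ->
  has_affine_dim (newton_polytope a) 3 ->
  noncompact_components (zero_set f) #<= `I_12.
Proof.
move=> fN dimN; apply: card_le_trans (nomial_card fN dimN) _.
by rewrite card_le_II.
Qed.
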